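(* Let $\rho>0$ and let $p_n(t)$, $n\ge 0$, be the conditional sojourn time density in the $M/M/1$ processor sharing queue with balking $b_n=1/(n+1)$ (service rate $1$, arrival rate $\rho$). For $\theta>0$ its Laplace transform $\widehat{p}_n(\theta)=\int_0^\infty p_n(t)e^{-\theta t}\,dt$ is $$\widehat{p}_n(\theta)=M\,G_n\sum_{l=0}^n\frac{\rho^l}{l!}\,H_l+M\,H_n\sum_{l=n+1}^\infty\frac{\rho^l}{l!}\,G_l,$$ where $$r=r(\theta)=\frac{\rho\,\theta}{(1+\theta)^2},\qquad M=M(\theta)=\frac{\rho^{r+1}}{(1+\theta)\,\Gamma(r+1)}\,e^{r/\theta},$$ $$G_n=G_n(\theta)=\int_0^{\frac{1}{1+\theta}}z^n\Big(\frac{1}{1+\theta}-z\Big)^r\exp\Big(-\frac{\rho z}{1+\theta}\Big)dz,$$ $$H_n=H_n(\theta)=\int_{\frac{1}{1+\theta}}^\infty z^n\Big(z-\frac{1}{1+\theta}\Big)^r\exp\Big(-\frac{\rho z}{1+\theta}\Big)dz.$$ The first two conditional moments of the sojourn time are $$\int_0^\infty t\,p_n(t)\,dt=\frac{n+\rho}{2}+1,$$ $$\int_0^\infty t^2\,p_n(t)\,dt=\frac{n^2}{3}+\Big(\frac53+\frac{5}{6}\rho\Big)n+\frac{5}{6}\rho^2+3\rho+2.$$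
   Context: $\mathcal{V}_n$ denotes the sojourn time of a tagged customer who enters the PS queue and finds $n$ other customers present, and $\mathbf{V}_n(t)=\mathrm{Prob}[\mathcal{V}_n>t]$. With $b_n=1/(n+1)$, the functions $\mathbf{V}_n$ ($n\ge 0$, $t\ge 0$, $0\le \mathbf V_n\le 1$) are the bounded solution of $$\mathbf{V}'_n(t)=\frac{n}{n+1}\mathbf{V}_{n-1}(t)-\Big(1+\frac{\rho}{n+1}\Big)\mathbf{V}_n(t)+\frac{\rho}{n+1}\mathbf{V}_{n+1}(t),\qquad \mathbf{V}_n(0)=1.$$ The conditional sojourn time density is $p_n(t)=-\mathbf{V}_n'(t)$; equivalently $$p'_n(t)=\frac{n}{n+1}p_{n-1}(t)-\Big(1+\frac{\rho}{n+1}\Big)p_n(t)+\frac{\rho}{n+1}p_{n+1}(t),\quad t>0,\qquad p_n(0)=\frac{1}{n+1},\quad n\ge 0$$ (the term with $p_{n-1}$ is absent for $n=0$). *)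

(* Defs.v *)
From HB Require Import structures.
From mathcomp Require Import all_boot all_order all_algebra.
From mathcomp Require Import all_classical all_reals all_analysis.
Set Implicit Arguments.
Unset Strict Implicit.
Unset Printing Implicit Defensive.
Import Order.TTheory GRing.Theory Num.Theory.
Import numFieldNormedType.Exports.
Local Open Scope classical_set_scope.
Local Open Scope ring_scope.

Section PSQueue.
Context {R : realType}.
Implicit Types (rho theta : R) (V : nat -> R -> R).

(* [V n t] = Prob[sojourn time > t] for a tagged customer who finds [n] others
   present, characterized as the bounded solution of the backward equations on
   [0, +oo[.  The values of [V n] at negative times are irrelevant: the equation
   is imposed for t > 0, together with right-continuity at the initial time 0.
   For n = 0 the term in [V n.-1] has coefficient 0. *)
Definition sojourn_tail rho V : Prop :=
  [/\ forall n, V n 0 = 1,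
      forall n, V n @ (0 : R)^'+ --> (1 : R),
      forall n (t : R), 0 <= t -> 0 <= V n t <= 1
    & forall n (t : R), 0 < t ->
        is_derive t 1 (V n)
          (n%:R / n.+1%:R * V n.-1 t - (1 + rho / n.+1%:R) * V n t
           + rho / n.+1%:R * V n.+1 t)].

(* Meaningful for t > 0 only; its value at t = 0 does not affect integrals. *)
Definition sojourn_density V (n : nat) (t : R) : R := - derive1 (V n) t.

(* An extended real: equality with a finite value of the transform of a
   measurable function includes the integrability of the integrand. *)
Definition laplace (f : R -> R) theta : \bar R :=
  (\int[lebesgue_measure]_(t in `[0%R, +oo[) (f t * expR (- (theta * t)))%:E)%E.

Definition Gamma (x : R) : R :=
  \int[lebesgue_measure]_(t in `]0, +oo[) (t `^ (x - 1) * expR (- t)).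

Definition rexp rho theta : R := rho * theta / (1 + theta) ^+ 2.

Definition Mcoef rho theta : R :=
  rho `^ (rexp rho theta + 1) / ((1 + theta) * Gamma (rexp rho theta + 1))
  * expR (rexp rho theta / theta).

Definition Gint rho theta (n : nat) : R :=
  \int[lebesgue_measure]_(z in `[0, (1 + theta)^-1])
    (z ^+ n * ((1 + theta)^-1 - z) `^ rexp rho theta
     * expR (- (rho * z / (1 + theta)))).

Definition Hint rho theta (n : nat) : R :=
  \int[lebesgue_measure]_(z in `[(1 + theta)^-1, +oo[)
    (z ^+ n * (z - (1 + theta)^-1) `^ rexp rho theta
     * expR (- (rho * z / (1 + theta)))).

End PSQueue.

(* Main.v *)
Require Import Defs.
From HB Require Import structures.
From mathcomp Require Import all_boot all_order all_algebra.
From mathcomp Require Import all_classical all_reals all_analysis.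
From mathcomp Require Import measurable_realfun ring lra.
Set Implicit Arguments.
Unset Strict Implicit.
Unset Printing Implicit Defensive.
Import Order.TTheory GRing.Theory Num.Theory.
Import numFieldNormedType.Exports.
Local Open Scope classical_set_scope.
Local Open Scope ring_scope.

(** Multiplying the backward equations by [expR (- (theta * t))] and integrating
    turns them into a three-term recursion in the number [n] of customers found.
    The operator of this recursion, [recop], obeys a comparison principle
    ([recop_comparison]): a supersolution that is not too negative is
    nonnegative, because once negative it would decrease geometrically at rate
    [1 + rho^-1].  Comparison drives everything else.

    Moments.  For [theta > 0] let [transV k theta n] be the integral of
    [t ^+ k * V n t * expR (- (theta * t))].  These integrals satisfy recursions
    whose source for [k] is the solution for [k.-1] ([recop_transV]), and a
    geometric supersolution bounds them by [K * x ^+ n] uniformly in [theta]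
    ([transV_geometric]).  Monotone convergence as [theta] tends to [0] then shows
    that all powers of [t] are integrable against the tails and that the recursions
    persist at [theta = 0] ([recop_transV0]).  The polynomials of the theorem solve
    them for [k = 0] and [k = 1], and comparison gives uniqueness in this growth
    class ([Rintegral_V], [Rintegral_tV]).  Since the density is minus the right-hand
    side of the backward equations, its moments of order [k.+1] are again read off
    from the recursion ([sojourn_moment]).

    Laplace transform.  The transform [p] of the density is bounded and solves
    [recop rho theta p n = - 1].  With [a = (1 + theta)^-1], integrating the
    derivative of [z ^+ n * (z - a) * `|z - a| `^ r * expR (- (rho * a * z))] over
    [0, a] and over the half-line from [a] shows that [Gint] and [Hint] solve the
    homogeneous recursion, except for a source of [Gint] at [n = 0] ([recop_G],
    [recop_H]).  Their Casoratian is explicit ([casoratian]) and [Mcoef] is its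
    normalization ([M_H0]), so [Mcoef * rho ^+ l / l!] times [Hint] at the smaller
    and [Gint] at the larger of [n], [l] is a Green function ([green]).  The formula
    is the superposition of these Green functions over [l]; comparison shows that
    the superposition converges and equals the bounded solution [p]
    ([cvg_sum_green]). *)

(** * A three-term recursion and its comparison principle *)

Section Recurrence.
Context {R : realType}.
Implicit Types (rho theta : R) (u v d : nat -> R) (n : nat).

(** The backward generator minus [theta], acting on the number of customers
    found and multiplied by [n.+1] to clear denominators.  Both the Laplace
    transforms and the moments solve equations in this operator. *)
Definition recop rho theta u n : R :=
  n%:R * u n.-1 - (n.+1%:R * (1 + theta) + rho) * u n + rho * u n.+1.

Lemma recopB rho theta u v n :
  recop rho theta (fun m => u m - v m) n
  = recop rho theta u n - recop rho theta v n.
Proof. by rewrite /recop; ring. Qed.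

Lemma recop_sum rho theta (g : nat -> nat -> R) N n :
  recop rho theta (fun m => \sum_(0 <= l < N) g l m) n
  = \sum_(0 <= l < N) recop rho theta (g l) n.
Proof.
by rewrite /recop big_split/= sumrB !mulr_sumr.
Qed.

(** At the first index where a supersolution is negative it is also below its
    predecessor, and the inequality then forces it to decrease at least like
    a negative multiple of [(1 + rho^-1) ^+ j].  Applied to a difference and to
    its opposite, this is uniqueness among sequences of growth rate less than
    [1 + rho^-1]. *)
Lemma recop_comparison rho theta d (C y : R) : 0 < rho -> 0 <= theta ->
  0 < y < 1 + rho^-1 -> (forall n, recop rho theta d n <= 0) ->
  (forall n, - (C * y ^+ n) <= d n) -> forall n, 0 <= d n.
Proof.
move=> rho0 theta0 /andP[y0 yrho] Ld dC n; rewrite leNgt; apply/negP => dn.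
have [m dm mmin] : exists2 m, d m < 0 & forall k, (k < m)%N -> 0 <= d k.
  have ex : exists m, d m < 0 by exists n.
  have [m dm mmin] := ex_minnP ex; exists m => // k km.
  by rewrite leNgt; apply/negP => /mmin; rewrite leqNgt km.
pose x := 1 + rho^-1.
have x0 : 0 < x by rewrite addr_gt0// invr_gt0.
have step k : d k < 0 -> k%:R * (d k - d k.-1) <= 0 -> d k.+1 <= x * d k.
  move=> dk dkk; have := Ld k.
  rewrite /recop -natr1 => Ldk.
  have h0 : 0 <= - ((k%:R + 1) * theta * d k).
    by rewrite -mulrN mulr_ge0 ?oppr_ge0 ?(ltW dk)// mulr_ge0// addr_ge0.
  have h : rho * d k.+1 <= rho * (x * d k).
    rewrite /x mulrA mulrDr mulr1 mulfV ?gt_eqF//; lra.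
  by rewrite -(ler_pM2l rho0).
have grow j : d (m + j)%N <= x ^+ j * d m /\
    (m + j)%:R * (d (m + j)%N - d (m + j).-1) <= 0.
  elim: j => [|j [IH1 IH2]].
    rewrite addn0 expr0 mul1r; split => //.
    case: m dm mmin => [|m] dm mmin; first by rewrite mul0r.
    by rewrite pmulr_rle0// subr_le0 (le_trans (ltW dm))// mmin.
  have dmj : d (m + j)%N < 0.
    by rewrite (le_lt_trans IH1)// pmulr_rlt0// exprn_gt0.
  have dS := step _ dmj IH2; rewrite addnS; split.
    by rewrite (le_trans dS)// exprS -mulrA ler_pM2l.
  rewrite pmulr_rle0// subr_le0 (le_trans dS)// /x mulrDl mul1r gerDl.
  by rewrite pmulr_rle0 ?invr_gt0// ltW.
have yx : `|y / x| < 1.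
  by rewrite ger0_norm ?divr_ge0 ?ltW// ltr_pdivrMr// mul1r.
have : (fun j => C * y ^+ m * (y / x) ^+ j) @ \oo --> (0 : R).
  rewrite -[X in _ --> X](mulr0 (C * y ^+ m)).
  by apply: cvgMl_tmp; exact: cvg_expr.
have bd j : - d m <= C * y ^+ m * (y / x) ^+ j.
  rewrite expr_div_n mulrA ler_pdivlMr ?exprn_gt0// -mulrA -exprD.
  rewrite mulNr lerNl (le_trans (dC _))//.
  by have [+ _] := grow j; rewrite mulrC.
move=> cv; suff : - d m <= 0 by rewrite oppr_le0 leNgt dm.
apply: (cvgr_to_ge cv).
by apply: nearW => j; exact: bd.
Qed.

(** The powers of [x] are strict supersolutions, uniformly in [theta]; [x] lies
    halfway between [1] and the critical rate [1 + rho^-1] of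
    [recop_comparison]. *)
Lemma recop_geometric rho theta (x : R) n : 0 < rho -> 0 <= theta ->
  x = 1 + (2 * rho)^-1 ->
  recop rho theta (fun m => x ^+ m) n
  <= - (n.+1%:R * ((2 * (rho + 1))^-1 * x ^+ n)).
Proof.
move=> rho0 theta0 xE.
have rx : rho * x = rho + 2^-1.
  by rewrite xE mulrDr mulr1 invfM mulrCA mulfV ?gt_eqF// mulr1.
have x1 : 1 < x by rewrite xE ltrDl invr_gt0 mulr_gt0.
have x0 : 0 < x by apply: lt_trans x1.
have K0 : 0 < (2 * (rho + 1))^-1 by rewrite invr_gt0 mulr_gt0// addr_gt0.
have KE : (2 * (rho + 1))^-1 * (rho + 1) = 2^-1.
  by rewrite invfM -mulrA mulVf ?mulr1// gt_eqF// addr_gt0.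
rewrite /recop exprS.
have th : 0 <= theta * n.+1%:R * x ^+ n.
  by rewrite !mulr_ge0// exprn_ge0// ltW.
set K := _^-1 in K0 KE *.
have K2 : K <= 2^-1 by nra.
case: n th => [|n] th.
  rewrite expr0 in th *; nra.
rewrite /= exprS in th *; set y := x ^+ n in th *.
have y0 : 0 < y by rewrite exprn_gt0.
rewrite -(natr1 n.+1) in th *; set m := n.+1%:R in th *.
have m0 : 0 <= m by rewrite /m.
suff : m + (m + 1) * K * x <= (m + 1 - 2^-1) * x.
  move=> h; have := ler_wpM2r (ltW y0) h.
  have -> : rho * (x * (x * y)) = (rho + 2^-1) * x * y by rewrite -rx; ring.
  lra.
have -> : (m + 1) * K * x = K * x * m + K * x by ring.
have Kx : K * x + 1 <= x.
  have : K * (rho * x) + rho <= rho * x by rewrite rx; nra.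
  move=> h; rewrite -(ler_pM2l rho0); lra.
have : m * (K * x + 1) <= m * x by rewrite ler_wpM2l.
nra.
Qed.

(** The bound obtained for [z] involves neither [B] nor [theta]: this is what
    survives the passage to the limit [theta -> 0], where an a priori bound
    such as [theta^-1] is lost. *)
Lemma recop_geometric_bound rho theta (x B S : R) (s z : nat -> R) :
  0 < rho -> 0 <= theta -> x = 1 + (2 * rho)^-1 -> 0 <= S ->
  (forall n, s n <= S * x ^+ n) ->
  (forall n, recop rho theta z n = - (n.+1%:R * s n)) ->
  (forall n, z n <= B) -> forall n, z n <= 2 * (rho + 1) * S * x ^+ n.
Proof.
move=> rho0 theta0 xE S0 sS Lz zB n.
have x1 : 1 < x by rewrite xE ltrDl invr_gt0 mulr_gt0.
have x0 : 0 < x by apply: lt_trans x1.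
have c0 : 0 < 2 * (rho + 1) by rewrite mulr_gt0// addr_gt0.
rewrite -subr_ge0; move: n.
apply: (@recop_comparison rho theta _ `|B| x) => //.
- apply/andP; split => //; rewrite xE ltrD2l invfM.
  by rewrite gtr_pMl ?invr_gt0// invf_lt1 ?ltr1n.
- move=> n; rewrite recopB Lz.
  have -> : recop rho theta (fun m => 2 * (rho + 1) * S * x ^+ m) n
    = 2 * (rho + 1) * S * recop rho theta (fun m => x ^+ m) n.
    by rewrite /recop; ring.
  rewrite opprK -lerBrDr sub0r.
  have := @recop_geometric rho theta x n rho0 theta0 xE.
  have h : 0 <= 2 * (rho + 1) * S by rewrite mulr_ge0// ltW.
  move=> /(ler_wpM2l h)/le_trans; apply.
  rewrite mulrN lerN2 [leRHS]mulrCA ler_wpM2l//.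
  rewrite mulrA (mulrC _ S) -(mulrA S) mulfV ?gt_eqF// mulr1; exact: sS.
- move=> n; rewrite lerBrDr addrC -lerBrDr opprK.
  apply: (le_trans (zB n)); apply: (le_trans (ler_norm B)).
  apply: (@le_trans _ _ (`|B| * x ^+ n)).
    by rewrite ler_peMr// exprn_ege1// ltW.
  rewrite lerDr; apply: mulr_ge0; last exact/exprn_ge0/ltW.
  by apply: mulr_ge0 => //; exact: ltW.
Qed.

Lemma quadratic_le_expr (y : R) : 1 < y ->
  exists C, forall n, (1 + n%:R) ^+ 2 <= C * y ^+ n.
Proof.
move=> y1; pose l := ln y.
have l0 : 0 < l by rewrite ln_gt0.
exists (2 * y / l ^+ 2) => n.
have lK : expR l = y by rewrite lnK// posrE (lt_trans _ y1).
have -> : 2 * y / l ^+ 2 * y ^+ n = 2 / l ^+ 2 * expR (l * (1 + n%:R)).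
  by rewrite mulrDr mulr1 expRD (mulrC l) expRM_natl lK; ring.
have l1n : 0 <= l * (1 + n%:R) by rewrite mulr_ge0 ?ltW// ltr_wpDr.
have := expR_ge1Dxn 1 l1n => h.
have l2 : 0 < l ^+ 2 by rewrite exprn_gt0.
rewrite mulrAC ler_pdivlMr//.
have : (l * (1 + n%:R)) ^+ 2 / 2%N`!%:R <= expR (l * (1 + n%:R)).
  by apply: le_trans h; rewrite lerDr.
rewrite [2%N`!]/= ler_pdivrMr// exprMn mulrC (mulrC _ 2) => {}h.
exact: h.
Qed.
End Recurrence.

(** * Exponentially decaying integrands on half-lines *)

Section ExponentialDecay.
Context {R : realType}.
Notation mu := (@lebesgue_measure R).
Implicit Types (a c C : R) (f g F : R -> R).

(** Boundary terms at infinity vanish and integrals converge for this class,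
    which is stable under all the operations performed on the integrands. *)
Definition exp_decay a f := exists C c : R, 0 < c /\
  forall x, a <= x -> `|f x| <= C * expR (- (c * x)).

Lemma exp_decay_expR a c : 0 < c -> exp_decay a (fun x => expR (- (c * x))).
Proof.
move=> c0; exists 1, c; split => // x _.
by rewrite mul1r ger0_norm ?expR_ge0.
Qed.

Lemma exp_decay_le a f g :
  (forall x, a <= x -> `|f x| <= `|g x|) -> exp_decay a g -> exp_decay a f.
Proof.
move=> fg [C [c [c0 gC]]]; exists C, c; split => // x ax.
by rewrite (le_trans (fg _ ax))// gC.
Qed.

Lemma exp_decayZ a k f : exp_decay a f -> exp_decay a (fun x => k * f x).
Proof.
move=> [C [c [c0 fC]]]; exists (`|k| * C), c; split => // x ax.
by rewrite normrM -mulrA ler_wpM2l// fC.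
Qed.

Lemma exp_decay_ge0 a f : 0 <= a -> exp_decay a f -> exists C c : R,
  [/\ 0 < c, 0 <= C & forall x, a <= x -> `|f x| <= C * expR (- (c * x))].
Proof.
move=> a0 [C [c [c0 fC]]]; exists `|C|, c; split => // x ax.
by rewrite (le_trans (fC _ ax))// ler_wpM2r ?expR_ge0 ?ler_norm.
Qed.

Lemma exp_decayD a f g : 0 <= a ->
  exp_decay a f -> exp_decay a g -> exp_decay a (fun x => f x + g x).
Proof.
move=> a0 /(exp_decay_ge0 a0)[C [c [c0 C0 fC]]].
move=> /(exp_decay_ge0 a0)[D [d [d0 D0 gD]]].
exists (C + D), (Num.min c d); split; first by rewrite lt_min c0.
move=> x ax; rewrite (le_trans (ler_normD _ _))// mulrDl.
have x0 : 0 <= x by rewrite (le_trans a0).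
apply: lerD.
  rewrite (le_trans (fC _ ax))// ler_wpM2l// ler_expR lerN2 ler_wpM2r//.
  by rewrite ge_min lexx.
rewrite (le_trans (gD _ ax))// ler_wpM2l// ler_expR lerN2 ler_wpM2r//.
by rewrite ge_min lexx orbT.
Qed.

(** Half of the decay rate pays for each factor [x], since [y <= expR y]. *)
Lemma exp_decayMX a n f : 0 <= a ->
  exp_decay a f -> exp_decay a (fun x => x ^+ n * f x).
Proof.
move=> a0 fd; elim: n => [|n IH].
  by apply: exp_decay_le fd => x _; rewrite expr0 mul1r.
have [C [c [c0 C0 fC]]] := exp_decay_ge0 a0 IH.
exists (C * (2 / c)), (c / 2); split; first by rewrite divr_gt0.
move=> x ax; have x0 : 0 <= x by rewrite (le_trans a0).
rewrite exprS -mulrA normrM (ger0_norm x0).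
have -> : expR (- (c / 2 * x)) = expR (c / 2 * x) * expR (- (c * x)).
  by rewrite -expRD; congr expR; field.
apply: (@le_trans _ _ (x * (C * expR (- (c * x))))).
  by rewrite ler_wpM2l// fC.
rewrite mulrCA -mulrA ler_wpM2l// mulrA ler_wpM2r ?expR_ge0//.
have : c / 2 * x <= expR (c / 2 * x) by apply: le_trans (expR_ge1Dx _); lra.
move=> /(ler_wpM2l (_ : 0 <= 2 / c)) => /(_ _) h.
apply: le_trans (h _); last by rewrite divr_ge0// ltW.
by rewrite le_eqVlt; apply/orP; left; apply/eqP; field; rewrite gt_eqF.
Qed.

Lemma exp_decay_cvg a f : exp_decay a f -> f x @[x --> +oo%R] --> (0 : R).
Proof.
move=> [C [c [c0 fC]]].
apply/cvgr0Pnorm_le => e e0.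
have h : (fun x => `|C| * expR (- (c * x))) x @[x --> +oo%R] --> (0 : R).
  rewrite -[X in _ --> X](mulr0 `|C|); apply: cvgMl_tmp.
  apply: (@cvg_comp _ _ _ (fun x => c * x) (fun x => expR (- x)) _ (pinfty_nbhs R)).
    exact: gt0_cvgMry.
  exact: cvgr_expR.
near=> x.
have ax : a <= x by near: x; apply: nbhs_pinfty_ge; exact: num_real.
apply: (le_trans (fC _ ax)).
apply: (@le_trans _ _ (`|C| * expR (- (c * x)))).
  by rewrite ler_wpM2r ?expR_ge0 ?ler_norm.
rewrite -[leLHS]ger0_norm ?mulr_ge0 ?expR_ge0//.
by near: x; move/cvgr0Pnorm_le : h; apply.
Unshelve. all: by end_near. Qed.

Lemma is_derive_expR_scaled (C c x : R) : c != 0 ->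
  is_derive x 1 (fun x : R => - (C / c * expR (- (c * x))))
   (C * expR (- (c * x))).
Proof.
move=> c0; apply: is_derive_eq; rewrite /GRing.scale/=; field.
exact: c0.
Qed.

Lemma is_derive_continuous (F : R -> R) (x df : R) :
  is_derive x 1 F df -> {for x, continuous F}.
Proof.
move=> dF; apply: differentiable_continuous; apply/derivable1_diffP.
exact: ex_derive.
Qed.

Lemma is_derive_expRN (c x : R) : is_derive x 1
  (fun s : R => expR (- (c * s))) (- c * expR (- (c * x))).
Proof. by apply: is_derive_eq; rewrite /GRing.scale/=; ring. Qed.

Lemma is_derive_exprn n (x : R) :
  is_derive x 1 (fun s : R => s ^+ n) (n%:R * x ^+ n.-1).
Proof.
apply: DeriveDef; first exact: exprn_derivable.
by rewrite exp_derive /GRing.scale/= mulr1.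
Qed.

Lemma continuous_expRN c : continuous (fun x : R => expR (- (c * x))).
Proof. by move=> x; exact: is_derive_continuous (is_derive_expRN c x). Qed.

Lemma within_continuous_expR (D : set R) (C c : R) :
  {within D, continuous (fun x : R => C * expR (- (c * x)))}.
Proof.
apply: continuous_subspaceT => x.
by apply: cvgMl_tmp; exact: continuous_expRN.
Qed.

Lemma integral_expR_scaled a C c : 0 <= C -> 0 < c ->
  (\int[mu]_(x in `[a, +oo[) (C * expR (- (c * x)))%:E
   = (C / c * expR (- (c * a)))%:E)%E.
Proof.
move=> C0 c0.
have dG x := is_derive_expR_scaled C x (lt0r_neq0 c0).
rewrite (@ge0_continuous_FTC2y _ _ (fun x => - (C / c * expR (- (c * x)))) a 0).
- by rewrite -EFinB sub0r opprK.
- by move=> x _; rewrite mulr_ge0 ?expR_ge0.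
- exact: within_continuous_expR.
- rewrite -oppr0; apply: cvgN.
  by apply: (@exp_decay_cvg a); apply/exp_decayZ/exp_decay_expR.
- by move=> x _; exact: (@ex_derive _ _ _ _ _ _ _ (dG x)).
- exact/cvg_at_right_filter/(is_derive_continuous (dG a)).
- by move=> x _; rewrite derive1E; exact: (@derive_val _ _ _ _ _ _ _ (dG x)).
Qed.

Lemma exp_decay_integrable a f : {within `[a, +oo[, continuous f} ->
  exp_decay a f -> mu.-integrable `[a, +oo[ (EFin \o f).
Proof.
move=> cf [C [c [c0 fC]]].
apply: (@le_integrable _ _ _ mu _ (measurable_itv _) _
  (EFin \o (fun x => `|C| * expR (- (c * x))))).
- by apply/measurable_EFinP; exact: subspace_continuous_measurable_fun.
- move=> x /=; rewrite in_itv/= andbT => ax; rewrite lee_fin (le_trans (fC _ ax))//.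
  rewrite [leRHS]ger0_norm ?mulr_ge0 ?expR_ge0//.
  by rewrite ler_wpM2r ?expR_ge0 ?ler_norm.
- apply/integrableP; split.
    apply/measurable_EFinP; apply: subspace_continuous_measurable_fun => //.
    exact: within_continuous_expR.
  under eq_integral => x _ do
    rewrite /= ger0_norm ?mulr_ge0 ?expR_ge0//.
  by rewrite integral_expR_scaled// ltry.
Qed.

(** [Rintegral_ge0_continuous_FTC2y] asks for a nonnegative integrand.  Adding a
    multiple of [expR (- (c * x))] that dominates [f] reduces to this case, as
    the added term has an explicit antiderivative. *)
Lemma exp_decay_FTC a f F : {within `[a, +oo[, continuous f} ->
  exp_decay a f -> exp_decay a F -> F x @[x --> a^'+] --> F a ->
  (forall x : R, a < x -> is_derive x 1 F (f x)) ->
  \int[mu]_(x in `[a, +oo[) f x = - F a.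
Proof.
move=> cf fd Fd Fa dF.
have intf := exp_decay_integrable cf fd.
case: (fd) => C [c [c0 fC]].
pose g (x : R) : R := `|C| * expR (- (c * x)).
pose G (x : R) : R := - (`|C| / c * expR (- (c * x))).
have dG (x : R) : is_derive x 1 G (g x) :=
  is_derive_expR_scaled `|C| x (lt0r_neq0 c0).
have gd : exp_decay a g by apply/exp_decayZ/exp_decay_expR.
have cg : {within `[a, +oo[, continuous g} by exact: within_continuous_expR.
have intg := exp_decay_integrable cg gd.
have Ig : \int[mu]_(x in `[a, +oo[) g x = - G a.
  by rewrite /Rintegral integral_expR_scaled// /G opprK.
suff : \int[mu]_(x in `[a, +oo[) (f x + g x) = - F a - G a.
  by rewrite RintegralD// Ig => /addIr.
have dFG (x : R) : a < x -> is_derive x 1 (F \+ G) (f x + g x).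
  by move=> ax; apply: is_deriveD; exact: dF.
rewrite (@Rintegral_ge0_continuous_FTC2y _ _ (F \+ G) a 0).
- by rewrite /=; ring.
- move=> x ax; have := fC x ax; rewrite ler_norml => /andP[+ _].
  rewrite -subr_ge0 opprK => /le_trans; apply.
  by rewrite lerD2l ler_wpM2r ?expR_ge0 ?ler_norm.
- move=> x; apply: cvgD; [exact: cf|exact: cg].
- rewrite -[X in _ --> X]addr0; apply: cvgD; first exact: exp_decay_cvg Fd.
  rewrite -oppr0; apply: cvgN.
  by apply: (@exp_decay_cvg a); apply/exp_decayZ/exp_decay_expR.
- by move=> x ax; exact: (@ex_derive _ _ _ _ _ _ _ (dFG x ax)).
- apply: cvgD => //.
  exact/cvg_at_right_filter/(is_derive_continuous (dG a)).
- move=> x; rewrite in_itv/= andbT => ax.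
  by rewrite derive1E; exact: (@derive_val _ _ _ _ _ _ _ (dFG x ax)).
Qed.

End ExponentialDecay.

(** * Transforms of the sojourn time tails and the moments *)

Section WithinContinuous.
Context {R : realType}.
Implicit Types (D : set R) (f g : R -> R).

Lemma within_continuousD D f g : {within D, continuous f} ->
  {within D, continuous g} -> {within D, continuous (fun x => f x + g x)}.
Proof. by move=> cf cg x; apply: cvgD; [exact: cf|exact: cg]. Qed.

Lemma within_continuousM D f g : {within D, continuous f} ->
  {within D, continuous g} -> {within D, continuous (fun x => f x * g x)}.
Proof. by move=> cf cg x; apply: cvgM; [exact: cf|exact: cg]. Qed.

Lemma within_continuousZ D (k : R) f : {within D, continuous f} ->
  {within D, continuous (fun x => k * f x)}.
Proof. by move=> cf x; apply: cvgMl_tmp; exact: cf. Qed.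

Lemma within_continuousX D k : {within D, continuous (fun x : R => x ^+ k)}.
Proof.
apply: continuous_subspaceT => x; exact: exprn_continuous.
Qed.

End WithinContinuous.

Section RealIntegrable.
Context {R : realType}.
Notation mu := (@lebesgue_measure R).
Implicit Types (i : interval R) (f g : R -> R).

Lemma integrable_EFinD i f g : mu.-integrable [set` i] (EFin \o f) ->
  mu.-integrable [set` i] (EFin \o g) ->
  mu.-integrable [set` i] (EFin \o (fun x => f x + g x)).
Proof. exact: (@integrableD _ _ R mu). Qed.

Lemma integrable_EFinB i f g : mu.-integrable [set` i] (EFin \o f) ->
  mu.-integrable [set` i] (EFin \o g) ->
  mu.-integrable [set` i] (EFin \o (fun x => f x - g x)).
Proof. exact: (@integrableB _ _ R mu). Qed.

Lemma integrable_EFinZ i (k : R) f : mu.-integrable [set` i] (EFin \o f) ->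
  mu.-integrable [set` i] (EFin \o (fun x => k * f x)).
Proof. exact: (@integrableZl _ _ R mu). Qed.

End RealIntegrable.

Section Sojourn.
Context {R : realType}.
Notation mu := (@lebesgue_measure R).
Variables (rho : R) (V : nat -> R -> R).
Hypotheses (hrho : 0 < rho) (hV : sojourn_tail rho V).
Implicit Types (theta t : R) (u : nat -> R) (n k : nat).

(** The right-hand side of the backward equations. *)
Definition drift u n : R :=
  n%:R / n.+1%:R * u n.-1 - (1 + rho / n.+1%:R) * u n
  + rho / n.+1%:R * u n.+1.

Lemma driftE u n : n.+1%:R * drift u n = recop rho 0 u n.
Proof. by rewrite /drift /recop; field; rewrite ?nat1r ?natr1 pnatr_eq0. Qed.

(** The power [k] makes Laplace transforms ([k = 0]) and moments ([theta = 0])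
    instances of one family of integrals. *)
Definition kernelV k theta n t : R := t ^+ k * (V n t * expR (- (theta * t))).

Definition transV k theta n : R :=
  \int[mu]_(t in `[0, +oo[) kernelV k theta n t.

Lemma V_ge0 n t : 0 <= t -> 0 <= V n t.
Proof. by case: hV => _ _ V01 _ /(V01 n)/andP[]. Qed.

Lemma V_le1 n t : 0 <= t -> V n t <= 1.
Proof. by case: hV => _ _ V01 _ /(V01 n)/andP[]. Qed.

Lemma V_derive n t : 0 < t -> is_derive t 1 (V n) (drift (V ^~ t) n).
Proof. by case: hV => _ _ _ dV; exact: dV. Qed.

Lemma V_continuous n : {within `[0, +oo[, continuous (V n)}.
Proof.
case: (hV) => V0 V0p _ _; apply/continuous_within_itvcyP; split.
  move=> t; rewrite in_itv/= andbT => t0.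
  exact: is_derive_continuous (V_derive n t0).
by rewrite V0; exact: V0p.
Qed.

Lemma kernelV_continuous k theta n :
  {within `[0, +oo[, continuous (kernelV k theta n)}.
Proof.
apply: within_continuousM; first exact: within_continuousX.
apply: within_continuousM; first exact: V_continuous.
exact/continuous_subspaceT/continuous_expRN.
Qed.

Lemma kernelV_ge0 k theta n t : 0 <= t -> 0 <= kernelV k theta n t.
Proof.
by move=> t0; rewrite /kernelV !mulr_ge0 ?exprn_ge0 ?expR_ge0 ?V_ge0.
Qed.

Lemma kernelV_le k theta n t :
  0 <= t -> kernelV k theta n t <= t ^+ k * expR (- (theta * t)).
Proof.
move=> t0; rewrite /kernelV ler_wpM2l ?exprn_ge0//.
by rewrite ler_piMl ?expR_ge0 ?V_le1.
Qed.

Lemma kernelV_decay k theta n : 0 < theta -> exp_decay 0 (kernelV k theta n).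
Proof.
move=> theta0.
apply: (@exp_decay_le _ _ _ (fun t => t ^+ k * expR (- (theta * t)))).
  move=> t t0; rewrite !ger0_norm ?kernelV_ge0//; last first.
    by rewrite mulr_ge0 ?exprn_ge0 ?expR_ge0.
  exact: kernelV_le.
exact/exp_decayMX/exp_decay_expR.
Qed.

Lemma kernelV_integrable k theta n : 0 < theta ->
  mu.-integrable `[0, +oo[ (EFin \o kernelV k theta n).
Proof.
move=> theta0; apply: exp_decay_integrable; first exact: kernelV_continuous.
exact: kernelV_decay.
Qed.

Section drift_integral.
Variables (k : nat) (theta : R).
Hypothesis intW :
  forall n, mu.-integrable `[0, +oo[ (EFin \o kernelV k theta n).

Lemma drift_integrable n :
  mu.-integrable `[0, +oo[ (EFin \o (fun t => drift (kernelV k theta ^~ t) n)).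
Proof.
apply: integrable_EFinD; last exact: integrable_EFinZ.
by apply: integrable_EFinB; exact: integrable_EFinZ.
Qed.

Lemma drift_Rintegral n :
  \int[mu]_(t in `[0, +oo[) drift (kernelV k theta ^~ t) n
  = drift (transV k theta) n.
Proof.
rewrite /drift RintegralD//; last 2 first.
  by apply: integrable_EFinB; exact: integrable_EFinZ.
  exact: integrable_EFinZ.
rewrite RintegralB//; [|exact: integrable_EFinZ..].
by rewrite !RintegralZl.
Qed.

(** The backward equations express the density through the tails, so its weighted
    integrals need no integration by parts, only integrability of the tails
    with the same weight. *)
Lemma integral_density (h : R -> R) n :
  (forall t, 0 < t ->
    h t = t ^+ k * (sojourn_density V n t * expR (- (theta * t)))) ->
  (\int[mu]_(t in `[0%R, +oo[) (h t)%:E = (- drift (transV k theta) n)%:E)%E.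
Proof.
move=> hE.
have hD t : 0 < t -> h t = - drift (kernelV k theta ^~ t) n.
  move=> t0; rewrite hE// /sojourn_density derive1E.
  rewrite (@derive_val _ _ _ _ _ _ _ (V_derive n t0)).
  by rewrite /drift /kernelV; ring.
have intD : mu.-integrable `[0, +oo[
    (EFin \o (fun t => - 1 * drift (kernelV k theta ^~ t) n)).
  exact/integrable_EFinZ/drift_integrable.
have intD' : mu.-integrable `]0, +oo[
    (EFin \o (fun t => - drift (kernelV k theta ^~ t) n)).
  under [X in _.-integrable _ X]eq_fun do rewrite -mulN1r.
  apply: integrableS intD => //.
  by apply: subset_itvr; rewrite bnd_simp.
rewrite -integral_itv_obnd_cbnd; last first.
  apply: eq_measurable_fun (measurable_int mu intD') => t.
  by rewrite inE/= in_itv/= andbT => t0; rewrite hD.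
under eq_integral.
  move=> t; rewrite inE/= in_itv/= andbT => t0; rewrite hD//; over.
rewrite integral_itv_obnd_cbnd; last exact: (measurable_int mu intD').
rewrite -drift_Rintegral.
under eq_integral do rewrite EFinN.
rewrite integralN/=; last exact/integrable_add_def/drift_integrable.
rewrite EFinN /Rintegral fineK//.
by apply: integrable_fin_num => //; exact: drift_integrable.
Qed.

End drift_integral.

Lemma drift_decay k theta n : 0 < theta ->
  exp_decay 0 (fun t => drift (kernelV k theta ^~ t) n).
Proof.
move=> theta0; rewrite /drift; apply: exp_decayD => //.
  apply: exp_decayD => //; first by apply/exp_decayZ; exact: kernelV_decay.
  apply: (@exp_decay_le _ _ _
    (fun t => (1 + rho / n.+1%:R) * kernelV k theta n t)).
    by move=> t _; rewrite normrN.
  by apply/exp_decayZ; exact: kernelV_decay.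
by apply/exp_decayZ; exact: kernelV_decay.
Qed.

Lemma drift_continuous k theta n :
  {within `[0, +oo[, continuous (fun t => drift (kernelV k theta ^~ t) n)}.
Proof.
have c m := @kernelV_continuous k theta m.
rewrite /drift; apply: within_continuousD; last exact: within_continuousZ.
under [X in continuous X]eq_fun do rewrite -mulNr.
by apply: within_continuousD; exact: within_continuousZ.
Qed.

Lemma kernelV_derive k theta n t : 0 < t ->
  is_derive t 1 (kernelV k theta n)
    (k%:R * kernelV k.-1 theta n t
     + (drift (kernelV k theta ^~ t) n + - theta * kernelV k theta n t)).
Proof.
move=> t0; have dV := V_derive n t0.
have dX := is_derive_exprn k t; have dE := is_derive_expRN theta t.
apply: (is_derive_eq (is_deriveM dX (is_deriveM dV dE))).
by rewrite /GRing.scale/= fctE /drift /kernelV; ring.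
Qed.

(** Integrate the derivative of [kernelV k theta n]; the boundary term at [0] is
    present only for [k = 0]. *)
Lemma recop_transV k theta n : 0 < theta ->
  recop rho theta (transV k theta) n
  = - (n.+1%:R * (k%:R * transV k.-1 theta n + (k == 0%N)%:R)).
Proof.
move=> theta0.
have int j m := @kernelV_integrable j theta m theta0.
have decay j m := @kernelV_decay j theta m theta0.
have intN : mu.-integrable `[0, +oo[
    (EFin \o (fun t => - theta * kernelV k theta n t)).
  exact: integrable_EFinZ.
have : k%:R * transV k.-1 theta n
    + (drift (transV k theta) n - theta * transV k theta n)
    = - kernelV k theta n 0.
  transitivity (\int[mu]_(t in `[0, +oo[) (k%:R * kernelV k.-1 theta n t
     + (drift (kernelV k theta ^~ t) n + - theta * kernelV k theta n t))).
    rewrite RintegralD//; last 2 first.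
      exact: integrable_EFinZ.
      by apply: integrable_EFinD => //; exact: drift_integrable.
    rewrite RintegralD//; last exact: drift_integrable.
    by rewrite drift_Rintegral// !RintegralZl// mulNr.
  apply: exp_decay_FTC.
  - apply: within_continuousD.
      exact/within_continuousZ/kernelV_continuous.
    apply: within_continuousD; first exact: drift_continuous.
    exact/within_continuousZ/kernelV_continuous.
  - apply: exp_decayD => //; first exact: exp_decayZ.
    by apply: exp_decayD => //; [exact: drift_decay|exact: exp_decayZ].
  - exact: decay.
  - by have /continuous_within_itvcyP[] := @kernelV_continuous k theta n.
  - by move=> t t0; exact: kernelV_derive.
have -> : kernelV k theta n 0 = (k == 0%N)%:R.
  by rewrite /kernelV; case: hV => -> _ _ _; rewrite mulr0 oppr0 expR0 !mulr1 expr0n.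
have -> : recop rho theta (transV k theta) n
  = n.+1%:R * (drift (transV k theta) n - theta * transV k theta n).
  by rewrite mulrBr driftE /recop; ring.
by move=> h; rewrite -[RHS]mulrN; congr (_ * _); lra.
Qed.

Lemma transV_ge0 k theta n : 0 <= transV k theta n.
Proof.
by apply: Rintegral_ge0 => t /=; rewrite in_itv/= andbT; exact: kernelV_ge0.
Qed.

Lemma transV_bounded k theta : 0 < theta ->
  exists B, forall n, transV k theta n <= B.
Proof.
move=> theta0; pose g t := t ^+ k * expR (- (theta * t)).
exists (\int[mu]_(t in `[0, +oo[) g t) => n.
apply: le_Rintegral => //; first exact: kernelV_integrable.
  apply: exp_decay_integrable; last exact/exp_decayMX/exp_decay_expR.
  apply: within_continuousM; first exact: within_continuousX.
  exact/continuous_subspaceT/continuous_expRN.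
by move=> t /=; rewrite in_itv/= andbT; exact: kernelV_le.
Qed.

Let x : R := 1 + (2 * rho)^-1.

Let x1 : 1 < x.
Proof. by rewrite /x ltrDl invr_gt0 mulr_gt0. Qed.

(** By induction on [k], since by [recop_transV] the source of the equation for
    [k] is [k] times the transform for [k.-1]. *)
Lemma transV_geometric k : exists2 K, 0 <= K &
  forall theta n, 0 < theta -> transV k theta n <= K * x ^+ n.
Proof.
have c0 : 0 <= 2 * (rho + 1) by rewrite mulr_ge0// addr_ge0// ltW.
have main j S : 0 <= S -> (forall theta n, 0 < theta ->
    j%:R * transV j.-1 theta n + (j == 0%N)%:R <= S * x ^+ n) ->
  exists2 K, 0 <= K &
    forall theta n, 0 < theta -> transV j theta n <= K * x ^+ n.
  move=> S0 hS; exists (2 * (rho + 1) * S); first by rewrite mulr_ge0.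
  move=> theta n theta0; have [B hB] := transV_bounded j theta0.
  apply: (@recop_geometric_bound _ rho theta x B S
    (fun n => j%:R * transV j.-1 theta n + (j == 0%N)%:R)) => //.
  - exact: ltW.
  - by move=> m; exact: hS.
  - by move=> m; rewrite recop_transV.
elim: k => [|k [K K0 hK]].
  apply: (main 0%N 1) => // theta n theta0.
  by rewrite mul0r add0r mul1r exprn_ege1// ltW.
apply: (main k.+1 (k.+1%:R * K)); first by rewrite mulr_ge0.
by move=> theta n theta0; rewrite addr0 -mulrA ler_wpM2l// hK.
Qed.

Let th (j : nat) : R := j.+1%:R^-1.

Let th_gt0 j : 0 < th j.
Proof. by rewrite invr_gt0. Qed.

Let cvg_th : th @ \oo --> (0 : R).
Proof. exact: cvg_harmonic. Qed.

Lemma cvg_kernelV k n t : kernelV k (th j) n t @[j --> \oo] --> kernelV k 0 n t.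
Proof.
apply: cvgMl_tmp; apply: cvgMl_tmp.
apply: continuous_cvg; first exact: continuous_expR.
by apply: cvgN; apply: cvgMr_tmp; exact: cvg_th.
Qed.

Lemma kernelV_nonincreasing k n t (a b : R) : 0 <= t -> a <= b ->
  kernelV k b n t <= kernelV k a n t.
Proof.
move=> t0 ab; rewrite /kernelV ler_wpM2l ?exprn_ge0// ler_wpM2l ?V_ge0//.
by rewrite ler_expR lerN2 ler_wpM2r.
Qed.

Lemma kernelV_measurable k theta n :
  measurable_fun `[(0 : R), +oo[ (kernelV k theta n).
Proof.
by apply: subspace_continuous_measurable_fun => //; exact: kernelV_continuous.
Qed.

Lemma transV_monotone k n :
  (\int[mu]_(t in `[0%R, +oo[) (kernelV k (th j) n t)%:E @[j --> \oo] -->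
   \int[mu]_(t in `[0%R, +oo[) (kernelV k 0 n t)%:E)%E.
Proof.
have -> : (\int[mu]_(t in `[0%R, +oo[) (kernelV k 0 n t)%:E =
    \int[mu]_(t in `[0%R, +oo[) (limn (fun j => (kernelV k (th j) n t)%:E)))%E.
  apply: eq_integral => t _; apply/esym/cvg_lim => //.
  apply: cvg_EFin; first exact: nearW.
  exact: cvg_kernelV.
apply: cvg_monotone_convergence => //.
- by move=> j; apply/measurable_EFinP; exact: kernelV_measurable.
- move=> j t /=; rewrite in_itv/= andbT => t0.
  by rewrite lee_fin kernelV_ge0.
- move=> t /=; rewrite in_itv/= andbT => t0 i j ij.
  by rewrite lee_fin kernelV_nonincreasing// lef_pV2 ?posrE// ler_nat.
Qed.

Lemma transV_EFin k theta n : 0 < theta ->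
  (\int[mu]_(t in `[0%R, +oo[) (kernelV k theta n t)%:E
   = (transV k theta n)%:E)%E.
Proof.
move=> theta0; rewrite /transV /Rintegral fineK//.
by apply: integrable_fin_num => //; exact: kernelV_integrable.
Qed.

(** Integrability of all powers of [t] against the tails comes from monotone
    convergence, the integrals for [theta > 0] being bounded uniformly. *)
Lemma kernelV0_integrable k n :
  mu.-integrable `[0, +oo[ (EFin \o kernelV k 0 n).
Proof.
apply/integrableP; split.
  by apply/measurable_EFinP; exact: kernelV_measurable.
under eq_integral => t.
  rewrite inE/= in_itv/= andbT => t0.
  rewrite ger0_norm ?kernelV_ge0//; over.
have [K K0 hK] := transV_geometric k.
apply: (@le_lt_trans _ _ (K * x ^+ n)%:E); last exact: ltry.
apply: (cvge_to_le (@transV_monotone k n)).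
by apply: nearW => j; rewrite transV_EFin// lee_fin hK.
Qed.

Lemma transV0_EFin k n :
  (\int[mu]_(t in `[0%R, +oo[) (kernelV k 0 n t)%:E = (transV k 0 n)%:E)%E.
Proof.
rewrite /transV /Rintegral fineK//.
by apply: integrable_fin_num => //; exact: kernelV0_integrable.
Qed.

Lemma cvg_transV k n : transV k (th j) n @[j --> \oo] --> transV k 0 n.
Proof.
have := @transV_monotone k n; rewrite transV0_EFin.
under eq_fun do rewrite transV_EFin//.
by move/fine_cvg.
Qed.

Lemma recop_transV0 k n : recop rho 0 (transV k 0) n
  = - (n.+1%:R * (k%:R * transV k.-1 0 n + (k == 0%N)%:R)).
Proof.
have cvL : recop rho (th j) (transV k (th j)) n @[j --> \oo] -->
    recop rho 0 (transV k 0) n.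
  apply: cvgD; last by apply: cvgMl_tmp; exact: cvg_transV.
  apply: cvgB; first by apply: cvgMl_tmp; exact: cvg_transV.
  apply: cvgM; last exact: cvg_transV.
  apply: cvgD; last exact: cvg_cst.
  apply: cvgMl_tmp; apply: cvgD; first exact: cvg_cst.
  exact: cvg_th.
have cvR : recop rho (th j) (transV k (th j)) n @[j --> \oo] -->
    - (n.+1%:R * (k%:R * transV k.-1 0 n + (k == 0%N)%:R)).
  under eq_fun do rewrite recop_transV//.
  apply: cvgN; apply: cvgMl_tmp; apply: cvgD; last exact: cvg_cst.
  by apply: cvgMl_tmp; exact: cvg_transV.
exact: cvg_unique cvL cvR.
Qed.

Lemma transV0_geometric k : exists2 K, 0 <= K &
  forall n, transV k 0 n <= K * x ^+ n.
Proof.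
have [K K0 hK] := transV_geometric k; exists K => // n.
by apply: (cvgr_to_le (@cvg_transV k n)); apply: nearW => j; exact: hK.
Qed.

Let x_lt : 0 < x < 1 + rho^-1.
Proof.
rewrite (lt_trans _ x1)//= ltrD2l invfM.
by rewrite gtr_pMl ?invr_gt0// invf_lt1 ?ltr1n.
Qed.

(** Quadratic growth, and the geometric growth of [transV_geometric], are both
    slower than the critical rate in [recop_comparison]. *)
Lemma transV0_unique k (q : nat -> R) (C : R) :
  (forall n, 0 <= q n <= C * (1 + n%:R) ^+ 2) ->
  (forall n, recop rho 0 q n = recop rho 0 (transV k 0) n) ->
  forall n, transV k 0 n = q n.
Proof.
move=> qb qE n; apply: le_anti; rewrite -subr_ge0 -[X in _ && X]subr_ge0.
apply/andP; split.
- have [K K0 hK] := transV0_geometric k.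
  move: n; apply: (@recop_comparison _ rho 0 _ K x) => //.
    by move=> n; rewrite recopB qE subrr.
  by move=> n; have /andP[q0 _] := qb n; have := hK n; lra.
- have [D hD] := quadratic_le_expr x1.
  move: n; apply: (@recop_comparison _ rho 0 _ (C * D) x) => //.
    by move=> n; rewrite recopB qE subrr.
  move=> n; have /andP[_ qn] := qb n.
  have C0 : 0 <= C.
    by have /andP[q0 q1] := qb 0%N; move: (le_trans q0 q1);
       rewrite addr0 expr1n mulr1.
  have := transV_ge0 k 0 n; have := ler_wpM2l C0 (hD n); rewrite mulrA; lra.
Qed.

Lemma Rintegral_V n : transV 0 0 n = (n%:R + rho) / 2 + 1.
Proof.
move: n; apply: (@transV0_unique _ _ (rho + 1)) => n.
  have n0 : 0 <= n%:R :> R by [].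
  have rn : 0 <= rho * n%:R by rewrite mulr_ge0// ltW.
  have rn2 : 0 <= rho * n%:R * n%:R by rewrite mulr_ge0.
  have nn : 0 <= n%:R * n%:R :> R by rewrite mulr_ge0.
  by have r0 := hrho; apply/andP; split; lra.
rewrite recop_transV0 /recop eqxx mul0r add0r mulr1 addr0 mulr1.
case: n => [|n]; first by rewrite /= mul0r; field.
by rewrite /= -!natr1; field.
Qed.

Lemma Rintegral_tV n : transV 1 0 n =
  (n%:R ^+ 2 / 3 + (5 / 3 + 5 / 6 * rho) * n%:R
          + 5 / 6 * rho ^+ 2 + 3 * rho + 2) / 2.
Proof.
move: n; apply: (@transV0_unique _ _ (rho ^+ 2 + 3 * rho + 2)) => n.
  have n0 : 0 <= n%:R :> R by [].
  have nn : 0 <= n%:R ^+ 2 :> R by rewrite exprn_ge0.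
  have rr : 0 <= rho ^+ 2 by rewrite exprn_ge0// ltW.
  have rn : 0 <= rho * n%:R by rewrite mulr_ge0// ltW.
  have rnn : 0 <= rho * n%:R ^+ 2 by rewrite mulr_ge0// ltW.
  have rrn : 0 <= rho ^+ 2 * n%:R by rewrite mulr_ge0.
  have rrnn : 0 <= rho ^+ 2 * n%:R ^+ 2 by rewrite mulr_ge0.
  by have r0 := hrho; apply/andP; split; lra.
rewrite recop_transV0 /recop/= Rintegral_V addr0 mulr1 mul1r addr0.
case: n => [|n]; first by rewrite /= mul0r; field.
by rewrite /= -!natr1; field.
Qed.

Lemma sojourn_moment (h : R -> R) k n :
  (forall t, 0 < t -> h t = t ^+ k.+1 * sojourn_density V n t) ->
  (\int[mu]_(t in `[0%R, +oo[) (h t)%:E = (k.+1%:R * transV k 0 n)%:E)%E.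
Proof.
move=> hE; rewrite (@integral_density k.+1 0 _ h n).
- congr EFin; have := recop_transV0 k.+1 n.
  have n0 : n.+1%:R != 0 :> R by rewrite pnatr_eq0.
  by rewrite -driftE -mulrN addr0 => /(mulfI n0) ->; rewrite opprK.
- by move=> m; exact: kernelV0_integrable.
- by move=> t t0; rewrite hE// mul0r oppr0 expR0 mulr1.
Qed.

Lemma laplace_density n theta : 0 < theta ->
  laplace (sojourn_density V n) theta = (1 - theta * transV 0 theta n)%:E.
Proof.
move=> theta0; rewrite /laplace (@integral_density 0 theta _ _ n).
- congr EFin; have := @recop_transV 0 theta n theta0.
  have -> : recop rho theta (transV 0 theta) n
    = n.+1%:R * (drift (transV 0 theta) n - theta * transV 0 theta n).
    by rewrite mulrBr driftE /recop; ring.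
  have n0 : n.+1%:R != 0 :> R by rewrite pnatr_eq0.
  by rewrite -[RHS]mulrN mul0r add0r eqxx mulr1n => /(mulfI n0); lra.
- by move=> m; exact: kernelV_integrable.
- by move=> t t0; rewrite mul1r.
Qed.

End Sojourn.

(** * The recursion for the integrals G and H *)

Section GHkernel.
Context {R : realType}.
Notation mu := (@lebesgue_measure R).
Variables (a b r : R).
Hypotheses (a0 : 0 < a) (b0 : 0 < b) (r0 : 0 < r).
Implicit Types (n : nat) (z : R).

(** The common form of the integrands of [Gint] (left of [a]) and of [Hint]
    (right of [a]): [((z - a) ^+ 2) `^ (r / 2)] is [`|z - a| `^ r], written as a
    function that is visibly differentiable at every [z != a]. *)
Definition ghkernel n z : R :=
  z ^+ n * (((z - a) ^+ 2) `^ (r / 2) * expR (- (b * z))).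

Let r2 : 0 < r / 2. Proof. by rewrite divr_gt0. Qed.

Lemma powR_sqr_derive z : z != a ->
  exists2 dp : R, (z - a) * dp = r * ((z - a) ^+ 2) `^ (r / 2) &
    is_derive z 1 (fun z : R => ((z - a) ^+ 2) `^ (r / 2)) dp.
Proof.
move=> za; have y0 : 0 < (z - a) ^+ 2.
  by rewrite lt_def sqr_ge0 andbT expf_eq0/= subr_eq0.
exists ((r / 2) * ((z - a) ^+ 2) `^ (r / 2 - 1) * (2 * (z - a))).
  by rewrite -[in RHS](mulr_powRB1 (ltW y0) r2); field.
have dS : is_derive z 1 (fun z : R => (z - a) ^+ 2) (2 * (z - a)).
  have d1 : is_derive z 1 (fun z : R => z - a) 1 by apply: is_derive_eq; ring.
  have -> : (fun z : R => (z - a) ^+ 2)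
      = (fun z : R => z - a) * (fun z : R => z - a).
    by apply/funext => x; rewrite fctE expr2.
  by apply: is_derive_eq; rewrite /GRing.scale/=; ring.
have := @is_derive1_powR _ (r / 2) _ y0 => dP.
exact: (@is_derive1_comp _ (fun y => y `^ (r / 2))
  (fun z => (z - a) ^+ 2) z _ _ dP dS).
Qed.

Lemma powR_sqr_continuous : continuous (fun z : R => ((z - a) ^+ 2) `^ (r / 2)).
Proof.
move=> z; have [->|za] := eqVneq z a; last first.
  by have [dp _ dP] := powR_sqr_derive za; exact: is_derive_continuous dP.
rewrite /continuous_at subrr expr0n/= powR0 ?gt_eqF//.
apply/cvgr0Pnorm_le => e e0; near=> x.
rewrite ger0_norm ?powR_ge0//.
have -> : e = (e `^ (r / 2)^-1) `^ (r / 2).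
  by rewrite -powRrM mulVf ?gt_eqF// powRr1// ltW.
apply: ge0_ler_powR; rewrite ?nnegrE ?sqr_ge0 ?powR_ge0 ?(ltW r2)//.
rewrite -[leLHS]ger0_norm ?sqr_ge0//; near: x.
have : (fun x : R => (x - a) ^+ 2) @ a --> (0 : R).
  rewrite -[X in _ --> X](expr0n R 2) -[X in X ^+ 2](subrr a).
  have h : (fun x : R => x - a) @ a --> a - a by apply: cvgB => //; exact: cvg_cst.
  by rewrite expr2; under eq_fun do rewrite expr2; exact: cvgM.
by move/cvgr0Pnorm_le; apply; rewrite powR_gt0.
Unshelve. all: by end_near. Qed.

Lemma ghkernel_continuous n : continuous (ghkernel n).
Proof.
move=> z; apply: cvgM; first exact: exprn_continuous.
by apply: cvgM; [exact: powR_sqr_continuous|exact: continuous_expRN].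
Qed.

Lemma ghkernel_ge0 n z : 0 <= z -> 0 <= ghkernel n z.
Proof. by move=> z0; rewrite !mulr_ge0 ?exprn_ge0 ?powR_ge0 ?expR_ge0. Qed.

(** The derivative of [(z - a) * ghkernel n z] is a combination of three
    consecutive [ghkernel m z]; for the [a], [b] and [r] of the queue its
    coefficients are those of [recop] divided by [- (1 + theta)]. *)
Definition flux (u : nat -> R) n : R :=
  (1 + r + n%:R + a * b) * u n + (- (n%:R * a) * u n.-1 + - b * u n.+1).

Lemma ghkernel_derive n z : z != a ->
  is_derive z 1 (fun z => (z - a) * ghkernel n z) (flux (ghkernel ^~ z) n).
Proof.
move=> za; have [dp dpE dP] := powR_sqr_derive za.
have dX := is_derive_exprn n z; have dE := is_derive_expRN b z.
have dA : is_derive z 1 (fun s : R => s - a) 1 by apply: is_derive_eq; ring.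
apply: (is_derive_eq (is_deriveM dA (is_deriveM dX (is_deriveM dP dE)))).
rewrite /GRing.scale/= !fctE /flux /ghkernel.
set E := expR _; set P := _ `^ _ in dpE *.
have nX : n%:R * z ^+ n = n%:R * z ^+ n.-1 * z.
  by case: n {dX} => [|n]; rewrite ?mul0r// exprSr mulrA.
transitivity ((z - a) * dp * (z ^+ n * E) + z ^+ n * P * E
  + (n%:R * z ^+ n.-1 * z - a * (n%:R * z ^+ n.-1)) * P * E
  - b * (z - a) * z ^+ n * P * E); first by ring.
by rewrite dpE -nX exprS; ring.
Qed.

Lemma flux_Rintegral (i : interval R) n :
  (forall m, mu.-integrable [set` i] (EFin \o ghkernel m)) ->
  \int[mu]_(z in [set` i]) flux (ghkernel ^~ z) n
  = flux (fun m => \int[mu]_(z in [set` i]) ghkernel m z) n.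
Proof.
move=> int; have intZ c m := @integrable_EFinZ _ i c _ (int m).
rewrite /flux RintegralD//; last by apply: integrable_EFinD; exact: intZ.
rewrite RintegralD//; [|exact: intZ..].
by rewrite !RintegralZl.
Qed.

Lemma flux_continuous n : continuous (fun z => flux (ghkernel ^~ z) n).
Proof.
move=> z; apply: cvgD; first by apply: cvgMl_tmp; exact: ghkernel_continuous.
by apply: cvgD; apply: cvgMl_tmp; exact: ghkernel_continuous.
Qed.

Let Fcont n : continuous (fun z => (z - a) * ghkernel n z).
Proof.
move=> z; apply: cvgM; last exact: ghkernel_continuous.
by apply: cvgB => //; exact: cvg_cst.
Qed.

Lemma ghkernel_integrable0a n : mu.-integrable `[0, a] (EFin \o ghkernel n).
Proof.
apply: continuous_compact_integrable; first exact: segment_compact.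
exact/continuous_subspaceT/ghkernel_continuous.
Qed.

(** The antiderivative vanishes at [a], and at [0] it vanishes unless
    [n = 0]. *)
Lemma flux_G n :
  flux (fun m => \int[mu]_(z in `[0, a]) ghkernel m z) n
  = (n == 0%N)%:R * (a * a `^ r).
Proof.
rewrite -flux_Rintegral; last exact: ghkernel_integrable0a.
rewrite /Rintegral (@continuous_FTC2 _ _ (fun z => (z - a) * ghkernel n z))//.
- rewrite -EFinB/= subrr mul0r sub0r add0r.
  rewrite /ghkernel mulr0 oppr0 expR0 expr0n sub0r sqrrN -(powR_mulrn 2 (ltW a0)).
  rewrite -powRrM (_ : 2%:R * (r / 2) = r); last by field.
  by ring.
- exact/continuous_subspaceT/flux_continuous.
- split.
  + move=> z; rewrite in_itv/= => /andP[_ za].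
    exact: (@ex_derive _ _ _ _ _ _ _ (ghkernel_derive n (negbT (lt_eqF za)))).
  + exact/cvg_at_right_filter/Fcont.
  + exact/cvg_at_left_filter/Fcont.
- move=> z; rewrite in_itv/= => /andP[_ za].
  rewrite derive1E.
  by rewrite (@derive_val _ _ _ _ _ _ _ (ghkernel_derive n (negbT (lt_eqF za)))).
Qed.

(** For [z >= a > 0] the factor [`|z - a| `^ r] is at most [z `^ r], itself
    dominated by a power of [z / a >= 1] with a natural exponent. *)
Lemma ghkernel_decay n : exp_decay a (ghkernel n).
Proof.
pose m := Num.bound (r / 2).
have rm : r / 2 <= m%:R by rewrite ltW// archi_boundP// ltW.
pose C := (a ^+ 2) `^ (r / 2) / (a ^+ 2) ^+ m.
apply: (@exp_decay_le _ _ _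
  (fun z => C * (z ^+ (n + 2 * m) * expR (- (b * z))))); last first.
  by apply/exp_decayZ/exp_decayMX; [exact: ltW|exact: exp_decay_expR].
move=> z az; have z0 : 0 <= z by rewrite (le_trans _ az)// ltW.
have C0 : 0 <= C by rewrite divr_ge0 ?powR_ge0// !exprn_ge0// ltW.
rewrite !ger0_norm ?ghkernel_ge0//; last first.
  by apply: mulr_ge0 => //; rewrite mulr_ge0 ?exprn_ge0 ?expR_ge0.
rewrite exprD exprM; set E := expR _.
have -> : C * (z ^+ n * (z ^+ 2) ^+ m * E) = z ^+ n * (C * (z ^+ 2) ^+ m * E).
  by ring.
rewrite ler_wpM2l ?exprn_ge0// ler_wpM2r ?expR_ge0//.
apply: (@le_trans _ _ ((z ^+ 2) `^ (r / 2))).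
  apply: ge0_ler_powR; rewrite ?nnegrE ?sqr_ge0 ?(ltW r2)//.
  by rewrite lerXn2r ?nnegrE ?subr_ge0// gerBl ltW.
have a20 : 0 < a ^+ 2 by rewrite exprn_gt0.
pose q := z ^+ 2 / a ^+ 2.
have q1 : 1 <= q by rewrite ler_pdivlMr// mul1r lerXn2r ?nnegrE// ltW.
have q0 : 0 <= q by rewrite (le_trans _ q1).
have -> : z ^+ 2 = a ^+ 2 * q by rewrite mulrC divfK// gt_eqF.
rewrite powRM ?(ltW a20)// exprMn mulrA /C mulfVK ?expf_neq0 ?gt_eqF//.
by rewrite ler_wpM2l ?powR_ge0// -(powR_mulrn m q0) ler_powR.
Qed.

Lemma ghkernel_integrableay n : mu.-integrable `[a, +oo[ (EFin \o ghkernel n).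
Proof.
apply: exp_decay_integrable; last exact: ghkernel_decay.
exact/continuous_subspaceT/ghkernel_continuous.
Qed.

(** The antiderivative vanishes at both ends of the half-line. *)
Lemma flux_H n :
  flux (fun m => \int[mu]_(z in `[a, +oo[) ghkernel m z) n = 0.
Proof.
rewrite -flux_Rintegral; last exact: ghkernel_integrableay.
transitivity (- ((a - a) * ghkernel n a)); last by rewrite subrr mul0r oppr0.
have d m : exp_decay a (ghkernel m) := ghkernel_decay m.
have a0' := ltW a0.
apply: (@exp_decay_FTC _ a _ (fun z => (z - a) * ghkernel n z)).
- exact/continuous_subspaceT/flux_continuous.
- apply: exp_decayD => //; first exact: exp_decayZ.
  by apply: exp_decayD => //; exact: exp_decayZ.
- apply: (@exp_decay_le _ _ _ (fun z => z ^+ 1 * ghkernel n z + - a * ghkernel n z)).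
    by move=> z _; rewrite expr1 -mulrDl.
  by apply: exp_decayD => //; [exact: exp_decayMX|exact: exp_decayZ].
- exact/cvg_at_right_filter/Fcont.
- by move=> z az; apply: ghkernel_derive; rewrite gt_eqF.
Qed.

End GHkernel.

(** * Normalization by the Gamma function *)

Section Normalization.
Context {R : realType}.
Notation mu := (@lebesgue_measure R).
Variables (a b r : R).
Hypotheses (a0 : 0 < a) (b0 : 0 < b) (r0 : 0 < r).

Let F (z : R) := b * (z - a).

Let dF (z : R) : is_derive z 1 F b.
Proof.
by apply: is_derive_eq; rewrite /GRing.scale/= ; ring.
Qed.

(** Substitution [s = b * (z - a)]. *)
Lemma ghkernel_scaling :
  \int[mu]_(s in `[0, +oo[) ghkernel 0 1 r 0 s
  = b `^ (r + 1) * expR (a * b) * \int[mu]_(z in `[a, +oo[) ghkernel a b r 0 z.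
Proof.
rewrite -RintegralZl//; last exact: ghkernel_integrableay.
rewrite /Rintegral; congr fine.
have Fa : F a = 0 by rewrite /F subrr mulr0.
have F'E : derive1 F = cst b.
  by apply/funext => z; rewrite derive1E; exact: (@derive_val _ _ _ _ _ _ _ (dF z)).
have Fcont (z : R) : {for z, continuous F} by exact: is_derive_continuous (dF z).
transitivity (\int[mu]_(s in `[F a, +oo[) (ghkernel 0 1 r 0 s)%:E)%E.
  by rewrite Fa.
rewrite (@increasing_ge0_integration_by_substitutiony _ F (ghkernel 0 1 r 0) a).
- apply: eq_integral => z; rewrite inE/= in_itv/= andbT => az; congr EFin.
  rewrite fctE/= F'E /cst /F /ghkernel !expr0 !mul1r subr0 exprMn.
  rewrite powRM ?sqr_ge0// -[b ^+ 2](powR_mulrn 2 (ltW b0)) -powRrM.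
  rewrite (_ : 2%:R * (r / 2) = r); last by field.
  rewrite (@powRD _ b r 1) ?(gt_eqF b0) ?implybT// powRr1 ?(ltW b0)//.
  have -> : - (b * (z - a)) = a * b + - (b * z) by ring.
  by rewrite expRD; ring.
- by move=> x y _ _ xy; rewrite /F ltr_pM2l// ltrD2r.
- by rewrite F'E => z _; exact: cst_continuous.
- by rewrite F'E; exact: is_cvg_cst.
- by rewrite F'E; exact: is_cvg_cst.
- split; last exact/cvg_at_right_filter/Fcont.
  by move=> z _; exact: (@ex_derive _ _ _ _ _ _ _ (dF z)).
- apply/cvgryPge => A; near=> z.
  rewrite /F -ler_pdivrMl// -lerBlDr opprK; near: z.
  by apply: nbhs_pinfty_ge; exact: num_real.
- exact/continuous_subspaceT/ghkernel_continuous.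
- by move=> z; rewrite Fa in_itv/= andbT => /ltW; exact: ghkernel_ge0.
Unshelve. all: by end_near. Qed.

Lemma GammaE : Gamma (r + 1) = \int[mu]_(s in `[0, +oo[) ghkernel 0 1 r 0 s.
Proof.
rewrite /Gamma /Rintegral; congr fine.
rewrite -[RHS]integral_itv_obnd_cbnd; last first.
  apply/measurable_EFinP; apply: subspace_continuous_measurable_fun => //.
  exact/continuous_subspaceT/ghkernel_continuous.
apply: eq_integral => t; rewrite inE/= in_itv/= andbT => t0; congr EFin.
rewrite /ghkernel addrK expr0 !mul1r subr0 -(powR_mulrn 2 (ltW t0)) -powRrM.
by rewrite (_ : 2%:R * (r / 2) = r); last by field.
Qed.

Lemma integral_ghkernel0_gt0 : 0 < \int[mu]_(z in `[a, +oo[) ghkernel a b r 0 z.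
Proof.
have a10 : 0 <= a + 1 by rewrite addr_ge0// ltW.
apply: (@lt_le_trans _ _ (1 / b * expR (- (b * (a + 1))))).
  by rewrite mulr_gt0 ?expR_gt0// divr_gt0.
rewrite -lee_fin -integral_expR_scaled//.
have -> : (\int[mu]_(z in `[a, +oo[) ghkernel a b r 0 z)%:E
    = (\int[mu]_(z in `[a, +oo[) (ghkernel a b r 0 z)%:E)%E.
  rewrite /Rintegral fineK//.
  by apply: integrable_fin_num => //; exact: ghkernel_integrableay.
have mK (i : interval R) : measurable_fun [set` i] (EFin \o ghkernel a b r 0).
  apply/measurable_EFinP; apply: subspace_continuous_measurable_fun => //.
  exact/continuous_subspaceT/ghkernel_continuous.
apply: (@le_trans _ _ (\int[mu]_(z in `[(a + 1)%R, +oo[) (ghkernel a b r 0 z)%:E)%E).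
  apply: ge0_le_integral => //.
  - apply/measurable_EFinP; apply: subspace_continuous_measurable_fun => //.
    exact: within_continuous_expR.
  - exact: mK.
  - move=> z /=; rewrite in_itv/= andbT => az.
    rewrite lee_fin /ghkernel expr0 mul1r ler_wpM2r ?expR_ge0//.
    have az1 : 1 <= (z - a) ^+ 2 by rewrite exprn_ege1// lerBrDr addrC.
    by rewrite -[leLHS](powRr0 ((z - a) ^+ 2)) ler_powR// divr_ge0// ltW.
apply: ge0_subset_integral => //.
- exact: mK.
- move=> z /=; rewrite in_itv/= andbT => az; rewrite lee_fin.
  by apply: ghkernel_ge0; rewrite (le_trans _ az)// ltW.
- by apply: subset_itvr; rewrite bnd_simp lerDl.
Qed.

End Normalization.

(** * Green function and the Laplace transform of the density *)

Section Kernels.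
Context {R : realType}.
Notation mu := (@lebesgue_measure R).
Variables (rho theta : R).
Hypotheses (rho0 : 0 < rho) (theta0 : 0 < theta).
Implicit Types (n l N : nat).

Let a := (1 + theta)^-1.
Let b := rho / (1 + theta).
Let r := rexp rho theta.
Let G := Gint rho theta.
Let H := Hint rho theta.
Let M := Mcoef rho theta.

Let t1 : 0 < 1 + theta. Proof. by rewrite addr_gt0. Qed.
Let a0 : 0 < a. Proof. by rewrite invr_gt0. Qed.
Let b0 : 0 < b. Proof. by rewrite divr_gt0. Qed.
Let r0 : 0 < r. Proof. by rewrite divr_gt0 ?mulr_gt0 ?exprn_gt0. Qed.

Lemma GintE n : G n = \int[mu]_(z in `[0, a]) ghkernel a b r n z.
Proof.
apply: eq_Rintegral => z; rewrite inE/= in_itv/= => /andP[z0 za].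
have az : 0 <= a - z by rewrite subr_ge0.
rewrite /ghkernel -/a -/r -sqrrN opprB -(powR_mulrn 2 az) -powRrM.
rewrite (_ : 2%:R * (r / 2) = r); last by field.
by rewrite (_ : b * z = rho * z / (1 + theta)) ?mulrA// /b mulrAC.
Qed.

Lemma HintE n : H n = \int[mu]_(z in `[a, +oo[) ghkernel a b r n z.
Proof.
apply: eq_Rintegral => z; rewrite inE/= in_itv/= andbT => az.
have za : 0 <= z - a by rewrite subr_ge0.
rewrite /ghkernel -/a -/r -(powR_mulrn 2 za) -powRrM.
rewrite (_ : 2%:R * (r / 2) = r); last by field.
by rewrite (_ : b * z = rho * z / (1 + theta)) ?mulrA// /b mulrAC.
Qed.

Lemma recop_flux (u : nat -> R) n :
  recop rho theta u n = - (1 + theta) * flux a b r u n.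
Proof.
have t10 := lt0r_neq0 t1.
by rewrite /recop /flux /a /b /r /rexp -natr1; field.
Qed.

Lemma recop_H n : recop rho theta H n = 0.
Proof.
rewrite recop_flux; have := flux_H a0 b0 r0 n; rewrite /flux -!HintE => ->.
by rewrite mulr0.
Qed.

Lemma recop_G n : recop rho theta G n = - ((n == 0%N)%:R * a `^ r).
Proof.
rewrite recop_flux; have := flux_G b a0 r0 n; rewrite /flux -!GintE => ->.
by rewrite -[1 + theta]invrK -/a; field; rewrite gt_eqF.
Qed.

Lemma G_ge0 n : 0 <= G n.
Proof.
rewrite GintE; apply: Rintegral_ge0 => z /=; rewrite in_itv/= => /andP[z0 _].
exact: ghkernel_ge0.
Qed.

Lemma G_le n : G n <= G 0%N.
Proof.
rewrite !GintE; apply: le_Rintegral => //; [exact: ghkernel_integrable0a..|].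
move=> z /=; rewrite in_itv/= => /andP[z0 za].
rewrite /ghkernel ler_wpM2r ?mulr_ge0 ?powR_ge0 ?expR_ge0// expr0 exprn_ile1//.
by rewrite (le_trans za)// invf_le1// lerDl ltW.
Qed.

Lemma H0_gt0 : 0 < H 0%N.
Proof. by rewrite HintE; exact: integral_ghkernel0_gt0. Qed.

Lemma H_gt0 n : 0 < H n.
Proof.
apply: (@lt_le_trans _ _ (a ^+ n * H 0%N)).
  by rewrite mulr_gt0 ?exprn_gt0 ?H0_gt0.
rewrite !HintE -RintegralZl//; last exact: ghkernel_integrableay.
apply: le_Rintegral => //.
- by apply: integrable_EFinZ; exact: ghkernel_integrableay.
- exact: ghkernel_integrableay.
- move=> z /=; rewrite in_itv/= andbT => az; have z0 := le_trans (ltW a0) az.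
  rewrite /ghkernel expr0 mul1r ler_wpM2r ?mulr_ge0 ?powR_ge0 ?expR_ge0//.
  by rewrite lerXn2r ?nnegrE// ltW.
Qed.

Lemma Gamma_gt0 : 0 < Gamma (r + 1).
Proof.
rewrite GammaE// (ghkernel_scaling a0 b0 r0) -HintE.
by rewrite !mulr_gt0 ?powR_gt0 ?expR_gt0 ?H0_gt0.
Qed.

Lemma M_gt0 : 0 < M.
Proof.
by rewrite /M /Mcoef mulr_gt0 ?expR_gt0// divr_gt0 ?powR_gt0// mulr_gt0 ?Gamma_gt0.
Qed.

(** The coefficient [M] is exactly what normalizes the jump of the Green
    function: [H 0] is a rescaled Gamma integral. *)
Lemma M_H0 : M * (a `^ r * H 0%N) = 1.
Proof.
have := Gamma_gt0; rewrite /M /Mcoef -/r GammaE// (ghkernel_scaling a0 b0 r0).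
rewrite -HintE => /lt0r_neq0; set h := H 0%N.
have -> : r / theta = a * b.
  by rewrite /r /rexp /a /b; field; rewrite !gt_eqF.
have -> : b `^ (r + 1) = rho `^ (r + 1) * (a `^ r * a).
  rewrite /b powRM ?(ltW rho0) ?(ltW a0)//; congr (_ * _).
  by rewrite powRD ?(gt_eqF a0) ?implybT// powRr1// ltW.
rewrite !mulf_eq0 !negb_or => /andP[/andP[/andP[rr /andP[ar aa]] ee] hh].
rewrite /a; field.
rewrite !invr_eq0 in aa *.
by rewrite rr ar ee hh aa.
Qed.

End Kernels.

Section Green.
Context {R : realType}.
Variables (rho theta A M : R) (G H : nat -> R).
Hypotheses (rho0 : 0 < rho) (theta0 : 0 < theta) (M_gt0 : 0 < M).
Hypotheses (recop_H : forall n, recop rho theta H n = 0)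
  (recop_G : forall n, recop rho theta G n = - ((n == 0%N)%:R * A))
  (H_gt0 : forall n, 0 < H n) (G_ge0 : forall n, 0 <= G n)
  (G_le : forall n, G n <= G 0%N) (M_H0 : M * (A * H 0%N) = 1).
Implicit Types (n l N : nat).

Let c l : R := rho ^+ l / l`!%:R.

Let c0 l : 0 < c l.
Proof. by rewrite divr_gt0 ?exprn_gt0// ltr0n fact_gt0. Qed.

(** The discrete analogue of the Wronskian: the recursion satisfied by both [G]
    and [H] makes this weighted determinant constant, and its value is read
    off at [n = 0], where only [G] has a source. *)
Lemma casoratian n :
  n.+1%:R * c n.+1 * (H n * G n.+1 - G n * H n.+1) = - (A * H 0%N).
Proof.
have cS m : m.+1%:R * c m.+1 = rho * c m.
  have f0 : m`!%:R != 0 :> R by rewrite pnatr_eq0 -lt0n fact_gt0.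
  have s0 : m.+1%:R != 0 :> R by rewrite pnatr_eq0.
  rewrite /c exprS factS natrM; set s := m.+1%:R in s0 *.
  by move: s s0 => s s0; field; rewrite f0 s0.
elim: n => [|n IH].
  have := recop_H 0; have := recop_G 0; rewrite cS /recop/= => hG hH.
  rewrite /c expr0 fact0 divr1 mulr1.
  transitivity
   (H 0%N * (0%:R * G 0%N - (1%:R * (1 + theta) + rho) * G 0%N + rho * G 1%N)
    - G 0%N * (0%:R * H 0%N - (1%:R * (1 + theta) + rho) * H 0%N
               + rho * H 1%N)).
    by ring.
  by rewrite hG hH; ring.
have := recop_H n.+1; have := recop_G n.+1; rewrite cS.
rewrite /recop/= mul0r oppr0 => hG hH.
have -> : rho * c n.+1 * (H n.+1 * G n.+2 - G n.+1 * H n.+2)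
  = c n.+1 * (H n.+1 * (n.+1%:R * G n - (n.+2%:R * (1 + theta) + rho) * G n.+1
       + rho * G n.+2)
     - G n.+1 * (n.+1%:R * H n - (n.+2%:R * (1 + theta) + rho) * H n.+1
       + rho * H n.+2)) + n.+1%:R * c n.+1 * (H n * G n.+1 - G n * H n.+1).
  by ring.
by rewrite hG hH !mulr0 subr0 mulr0 add0r.
Qed.

(** The Green function of [recop rho theta]: [H] solves the homogeneous equation
    including at [0], [G] is the solution that stays bounded, and [casoratian]
    gives the jump at [n = l]. *)
Definition green l n : R :=
  M * c l * (if (n <= l)%N then H n * G l else G n * H l).

Lemma green_le l n : (n <= l)%N -> green l n = M * c l * (H n * G l).
Proof. by rewrite /green => ->. Qed.

Lemma green_ge l n : (l <= n)%N -> green l n = M * c l * (G n * H l).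
Proof.
by rewrite /green leq_eqVlt => /predU1P[->|ln];
  rewrite ?leqnn ?(leqNgt n) ?ln// (mulrC (G n)).
Qed.

Lemma recop_green l n : recop rho theta (green l) n = - (n == l)%:R.
Proof.
have [nl|ln|->{n}] := ltngtP n l.
- rewrite /recop !green_le ?(ltnW nl)//; last first.
    by rewrite (leq_trans (leq_pred n))// ltnW.
  transitivity (M * c l * G l * recop rho theta H n).
    by rewrite /recop; ring.
  by rewrite recop_H mulr0 oppr0.
- rewrite /recop !green_ge ?(ltnW ln) ?(leqW (ltnW ln))//; last by case: n ln.
  transitivity (M * c l * H l * recop rho theta G n).
    by rewrite /recop; ring.
  by rewrite recop_G gtn_eqF ?(leq_ltn_trans _ ln)// mul0r oppr0 mulr0.
- rewrite /recop (@green_ge l l)// (@green_ge l l.+1)//.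
  rewrite (@green_le l l.-1) ?leq_pred//.
  case: l => [|l].
    have := recop_G 0; rewrite /recop/= => hG.
    transitivity (M * c 0 * H 0%N *
      (0%:R * G 0%N - (1%:R * (1 + theta) + rho) * G 0%N + rho * G 1%N)).
      by rewrite /=; ring.
    rewrite hG /c expr0 fact0 divr1 /=.
    by transitivity (- (M * (A * H 0%N))); [ring | rewrite M_H0].
  rewrite /=; have := recop_G l.+1; rewrite /recop/= mul0r oppr0 => hG.
  transitivity (M * c l.+1 * H l.+1 * (l.+1%:R * G l -
     (l.+2%:R * (1 + theta) + rho) * G l.+1 + rho * G l.+2)
     + M * (l.+1%:R * c l.+1 * (H l * G l.+1 - G l * H l.+1))).
    by ring.
  by rewrite hG casoratian mulr0 add0r mulrN M_H0.
Qed.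

Lemma green_ge0 l n : 0 <= green l n.
Proof.
have h1 := ltW M_gt0; have h2 := ltW (c0 l).
have h3 m := ltW (H_gt0 m).
apply: mulr_ge0; first exact: mulr_ge0.
by case: ifP => _; exact: mulr_ge0.
Qed.

Lemma green_bounded l : exists B, forall n, green l n <= B.
Proof.
exists (M * c l * (G 0%N * \sum_(0 <= m < l.+1) H m)) => n.
have Hge m : 0 <= H m := ltW (H_gt0 m).
have Mc : 0 <= M * c l by apply: mulr_ge0; exact: ltW.
rewrite ler_wpM2l//.
have Hle m : (m <= l)%N -> H m <= \sum_(0 <= m < l.+1) H m.
  move=> ml; rewrite big_mkord (bigD1 (Ordinal (ml : (m < l.+1)%N)))//= lerDl.
  by apply: sumr_ge0.
case: ifP => nl; first by rewrite mulrC ler_pM ?G_ge0 ?G_le ?Hle.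
by rewrite ler_pM ?G_ge0 ?G_le ?Hle.
Qed.

Lemma sum_green N n : (n < N)%N ->
  \sum_(0 <= l < N) green l n
  = M * G n * (\sum_(0 <= l < n.+1) c l * H l)
    + M * H n * (\sum_(n.+1 <= l < N) c l * G l).
Proof.
move=> nN; rewrite (big_cat_nat _ nN)//= !mulr_sumr; congr (_ + _).
  by apply: eq_big_nat => l /andP[_ ln]; rewrite green_ge//; ring.
by apply: eq_big_nat => l /andP[nl _]; rewrite green_le ?(ltnW nl)//; ring.
Qed.

Let sum_delta N n : \sum_(0 <= l < N) - (n == l)%:R = - (n < N)%:R :> R.
Proof.
elim: N => [|N IH]; first by rewrite big_geq// oppr0.
rewrite big_nat_recr//= {}IH ltnS (leq_eqVlt n).
by case: (ltngtP n N) => _ /=; ring.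
Qed.

Let y1 : 0 < (1 : R) < 1 + rho^-1.
Proof. by rewrite ltr01 ltrDl invr_gt0. Qed.

(** The partial sums of Green functions are bounded in [n], so that comparison
    puts them below [p]; their increasing limit is hence a solution lying between
    [0] and [p], and comparison again identifies it with [p].  No estimate on
    the growth of [H] against the decay of [G] enters. *)
Lemma cvg_sum_green (p : nat -> R) (C : R) :
  (forall n, recop rho theta p n = - 1) -> (forall n, `|p n| <= C) ->
  forall n, \sum_(0 <= l < N) green l n @[N --> \oo] --> p n.
Proof.
move=> Lp pC; pose Q N n := \sum_(0 <= l < N) green l n.
have LQ N n : recop rho theta (Q N) n = - (n < N)%:R.
  by rewrite recop_sum; under eq_bigr do rewrite recop_green; exact: sum_delta.
have QB N : exists B, forall n, Q N n <= B.
  elim: N => [|N [B hB]]; first by exists 0 => n; rewrite /Q big_geq.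
  have [D hD] := green_bounded N; exists (B + D) => n.
  by rewrite /Q big_nat_recr//= lerD ?hB ?hD.
have Qp N n : Q N n <= p n.
  have [B hB] := QB N; rewrite -subr_ge0; move: n.
  apply: (@recop_comparison _ rho theta _ (C + B) 1) => //; first exact: ltW.
    by move=> n; rewrite recopB Lp LQ opprK; case: (n < N)%N; rewrite /=; lra.
  move=> n; rewrite expr1n mulr1.
  by have := hB n; have := pC n; rewrite ler_norml => /andP[]; lra.
have Qnd n : nondecreasing_seq (Q ^~ n).
  apply/nondecreasing_seqP => N; rewrite /Q big_nat_recr//= lerDl; exact: green_ge0.
have Qcvg n : cvgn (Q ^~ n).
  apply: nondecreasing_is_cvgn; first exact: Qnd.
  by exists (p n) => _ [N _ <-]; exact: Qp.
pose q n := limn (Q ^~ n).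
have Qq n : Q N n @[N --> \oo] --> q n by exact: Qcvg.
have q0 n : 0 <= q n.
  apply: (cvgr_to_ge (Qq n)); apply: nearW => N.
  by apply: sumr_ge0 => l _; exact: green_ge0.
have qp n : q n <= p n by apply: (cvgr_to_le (Qq n)); exact: nearW.
have Lq n : recop rho theta q n = - 1.
  have cv : recop rho theta (Q N) n @[N --> \oo] --> recop rho theta q n.
    apply: cvgD; last exact: cvgMl_tmp.
    by apply: cvgB; exact: cvgMl_tmp.
  suff cv1 : recop rho theta (Q N) n @[N --> \oo] --> (- 1 : R).
    exact: cvg_unique cv cv1.
  apply: cvg_near_cst; near=> N; rewrite LQ.
  by have -> : (n < N)%N by near: N; exists n.+1.
suff pq n : p n <= q n.
  by move=> n; have -> : p n = q n; [apply: le_anti; rewrite pq qp | exact: Qq].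
rewrite -subr_ge0; move: n.
apply: (@recop_comparison _ rho theta _ C 1) => //; first exact: ltW.
  by move=> n; rewrite recopB Lq Lp subrr.
move=> n; rewrite expr1n mulr1.
by have := q0 n; have := pC n; rewrite ler_norml => /andP[]; lra.
Unshelve. all: by end_near. Qed.

Lemma green_formula (p : nat -> R) (C : R) n :
  (forall n, recop rho theta p n = - 1) -> (forall n, `|p n| <= C) ->
  cvgn (fun N => \sum_(n.+1 <= l < N) c l * G l) /\
  p n = M * G n * (\sum_(0 <= l < n.+1) c l * H l)
    + M * H n * limn (fun N => \sum_(n.+1 <= l < N) c l * G l).
Proof.
move=> Lp pC; have MH0 : M * H n != 0 by rewrite gt_eqF ?mulr_gt0.
set S := M * G n * _.
have cv : \sum_(n.+1 <= l < N) c l * G l @[N --> \oo]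
    --> (M * H n)^-1 * (p n - S).
  have h : (M * H n)^-1 * (\sum_(0 <= l < N) green l n - S) @[N --> \oo]
    --> (M * H n)^-1 * (p n - S).
    apply: cvgMl_tmp; apply: cvgB; last exact: cvg_cst.
    exact: (cvg_sum_green Lp pC).
  apply: cvg_trans h; apply: near_eq_cvg; near=> N.
  rewrite sum_green; first by rewrite addrC addKr mulKf.
  by near: N; exists n.+1.
split; first by apply/cvg_ex; eexists; exact: cv.
by rewrite (cvg_lim _ cv)// mulVKf// addrC subrK.
Unshelve. all: by end_near. Qed.

End Green.

Theorem theorem2p2 (R : realType) (rho : R) (V : nat -> R -> R)
  (hrho : 0 < rho) (hV : sojourn_tail rho V) :
  (forall (n : nat) (theta : R), 0 < theta ->
     let M := Mcoef rho theta in
     let G := Gint rho theta in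
     let H := Hint rho theta in
     cvgn (fun N => \sum_(n.+1 <= l < N) rho ^+ l / (l`!)%:R * G l) /\
     laplace (sojourn_density V n) theta =
       (M * G n * (\sum_(0 <= l < n.+1) rho ^+ l / (l`!)%:R * H l)
        + M * H n * (limn (fun N => \sum_(n.+1 <= l < N) rho ^+ l / (l`!)%:R * G l)))%:E) /\
  (forall n : nat,
     (\int[lebesgue_measure]_(t in `[0%R, +oo[) (t * sojourn_density V n t)%:E)%E
       = ((n%:R + rho) / 2 + 1)%:E) /\
  (forall n : nat,
     (\int[lebesgue_measure]_(t in `[0%R, +oo[) (t ^+ 2 * sojourn_density V n t)%:E)%E
       = (n%:R ^+ 2 / 3 + (5 / 3 + 5 / 6 * rho) * n%:R
          + 5 / 6 * rho ^+ 2 + 3 * rho + 2)%:E).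
Proof.
split=> [n theta theta0 M G H|].
  have [B hB] := transV_bounded hV 0 theta0.
  pose p m := 1 - theta * transV V 0 theta m.
  have Lp m : recop rho theta p m = - 1.
    have := recop_transV hV 0 m theta0; rewrite /p /recop mul0r add0r eqxx mulr1.
    rewrite -natr1 => h.
    (* only the coefficients matter: [recop] sends the constant [1] to
       [- 1 - m.+1%:R * theta] *)
    have -> : forall x y z : R, m%:R * (1 - theta * x)
        - ((m%:R + 1) * (1 + theta) + rho) * (1 - theta * y) + rho * (1 - theta * z)
      = - 1 - (m%:R + 1) * theta
       - theta * (m%:R * x - ((m%:R + 1) * (1 + theta) + rho) * y + rho * z).
      by move=> x y z; ring.
    by rewrite h; ring.
  have pB m : `|p m| <= 1 + theta * B.
    have hm := hB m; have h0 := transV_ge0 hV 0 theta m.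
    have h1 := ler_wpM2l (ltW theta0) hm.
    have h2 := mulr_ge0 (ltW theta0) h0.
    by rewrite /p ler_norml; apply/andP; split; lra.
  have [cv pE] := green_formula hrho theta0 (M_gt0 (rho := rho) hrho theta0)
    (recop_H hrho theta0) (recop_G hrho theta0) (H_gt0 hrho theta0)
    (@G_ge0 _ rho theta) (G_le hrho theta0) (M_H0 hrho theta0) n Lp pB.
  by split => //; rewrite (laplace_density hV)// -pE.
split=> n.
  rewrite (@sojourn_moment _ _ _ hrho hV _ 0 n)//.
  by rewrite (Rintegral_V hrho hV) mul1r.
rewrite (@sojourn_moment _ _ _ hrho hV _ 1 n)//.
by rewrite (Rintegral_tV hrho hV); congr EFin; field.
Qed.
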